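(* Let $G$ be an Eulerian ribbon graph and let $F$ be a forest of $G$ (a ribbon subgraph whose underlying graph has no cycles). Then $G$ is checkerboard colourable if and only if $G/E(F)$ is checkerboard colourable.
   Context: A ribbon graph is a (possibly non-orientable) surface with boundary written as a union of vertex discs and edge discs meeting in disjoint line segments (common line segments), each lying on exactly one vertex and one edge, each edge containing exactly two. The two boundary arcs of an edge disc other than its common line segments are its edge line segments. The degree of a vertex is the number of common line segments on it; $G$ is Eulerian if all degrees are even (connectivity not required). $G$ is checkerboard colourable if its boundary components can be coloured with two colours so that the two edge line segments of each edge receive different colours. For $A\subseteq E(G)$, $G/A$ denotes the ribbon graph obtained by contracting the edges of $A$, i.e. $G/A=G^{\delta(A)}-A$, where $G^{\delta(A)}$ is the partial dual with respect to $A$ (in the arrow presentation: for each $e\in A$ with arrows $e',e''$, draw segments directed from the head of $e'$ to the tail of $e''$ and from the head of $e''$ to the tail of $e'$, both labelled $e$, and delete the arcs carrying $e',e''$). *)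

(* Defs.v *)
From mathcomp Require Import all_boot.

Set Implicit Arguments.
Unset Strict Implicit.
Unset Printing Implicit Defensive.

(** ** Connected components of a symmetric relation on a finite type *)

Section Component.
Variables (T : finType) (r : rel T).

Definition component_set (x : T) : {set T} := [set y | connect r x y].

Definition component : finType :=
  {C : {set T} | C \in [set component_set x | x : T]}.

Definition component_of (x : T) : component :=
  exist _ (component_set x) (imset_f component_set (isT : x \in T)).

End Component.

(** ** Ribbon graphs, given by arrow presentations

  Each label [e : E] occurs on two arrows, [(e, false)] and [(e, true)]; these
  are the two common line segments of the edge disc [e].  The end [(e, i, b)]
  is the head of the arrow [(e, i)] if [b = true] and its tail if [b = false].

  The arrows lie on disjoint circles, the boundaries of the vertex discs.
  Removing the arrows from the circles that carry some leaves arcs, each of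
  which joins two distinct arrow ends (possibly the two ends of one arrow, when
  this arrow is alone on its circle); [arc] exchanges the two ends of each arc.
  Any fixed-point free involution arises in this way, since arrows and arcs
  then alternate along closed curves.  The circles that carry no arrow, i.e.
  the isolated vertices, are not seen by [arc]: they are the elements of
  [bare]. *)

Definition arrow (E : finType) : finType := (E * bool)%type.
Definition arrow_end (E : finType) : finType := (arrow E * bool)%type.

Record ribbon_graph := RibbonGraph {
  edge : finType;
  bare : finType;
  arc : arrow_end edge -> arrow_end edge;
  arcK : involutive arc;
  arc_neq : forall x, arc x != x
}.

Section Ends.
Variable E : finType.
Implicit Type x : arrow_end E.

Definition edge_of x : E := x.1.1.

Definition across x : arrow_end E := (x.1, ~~ x.2).

(* The boundary of the edge disc [e] is oriented consistently with both of its
   arrows, so its edge line segments join the head of each of these arrows to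
   the tail of the other one. *)
Definition side x : arrow_end E := ((x.1.1, ~~ x.1.2), ~~ x.2).

Lemma acrossK : involutive across.
Proof. by case=> [[e i] b]; rewrite /across /= negbK. Qed.

Lemma across_neq x : across x != x.
Proof. by case: x => [[e i] []]; apply/eqP => -[]. Qed.

Lemma sideK : involutive side.
Proof. by case=> [[e i] b]; rewrite /side /= !negbK. Qed.

End Ends.

Section Structure.
Variable G : ribbon_graph.

Definition circle_rel : rel (arrow_end (edge G)) :=
  fun x y => (y == across x) || (y == arc x).

Definition boundary_rel : rel (arrow_end (edge G)) :=
  fun x y => (y == side x) || (y == arc x).

Definition vertex : finType := (component circle_rel + bare G)%type.

(* The boundary of an isolated vertex disc is a boundary component. *)
Definition boundary_component : finType :=
  (component boundary_rel + bare G)%type.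

Definition vertex_of (a : arrow (edge G)) : vertex :=
  inl (component_of circle_rel (a, true)).

Definition degree (v : vertex) : nat :=
  #|[set a : arrow (edge G) | vertex_of a == v]|.

Definition Eulerian : Prop := forall v : vertex, ~~ odd (degree v).

(* The edge line segment that meets the head of the arrow [a]; the two edge
   line segments of [e] are those of the arrows [(e, false)] and [(e, true)]. *)
Definition segment_boundary (a : arrow (edge G)) : boundary_component :=
  inl (component_of boundary_rel (a, true)).

Definition checkerboard_colourable : Prop :=
  exists c : boundary_component -> bool, forall e : edge G,
    c (segment_boundary (e, false)) != c (segment_boundary (e, true)).

(** ** Ribbon subgraphs and forests *)

Record ribbon_subgraph := RibbonSubgraph {
  sub_vertices : {set vertex};
  sub_edges : {set edge G};
  sub_incident : forall a : arrow (edge G),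
    a.1 \in sub_edges -> vertex_of a \in sub_vertices
}.

(* An arrow, viewed as a half-edge, stands for its edge traversed from the
   vertex carrying this arrow to the vertex carrying the other arrow with the
   same label.  Loops are cycles of length 1, and pairs of parallel edges are
   cycles of length 2. *)
Definition opposite (a : arrow (edge G)) : arrow (edge G) := (a.1, ~~ a.2).

Definition graph_cycle (s : seq (arrow (edge G))) : bool :=
  [&& s != [::],
      cycle (fun a b => vertex_of (opposite a) == vertex_of b) s,
      uniq [seq a.1 | a <- s] & uniq [seq vertex_of a | a <- s]].

Definition forest (F : ribbon_subgraph) : Prop :=
  forall s, {subset [seq a.1 | a <- s] <= sub_edges F} -> ~~ graph_cycle s.

End Structure.

(** ** Partial duals *)

Section PartialDual.
Variables (G : ribbon_graph) (A : {set edge G}).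

(* [dual_place x] is the end of an old arrow at which the end [x] of a new
   arrow is placed: for [e \in A], the new arrow [(e, i)] goes from the head of
   the old arrow [(e, i)] to the tail of the old arrow [(e, ~~ i)]. *)
Definition dual_place (x : arrow_end (edge G)) : arrow_end (edge G) :=
  let: ((e, i), b) := x in
  if e \in A then if b then ((e, ~~ i), false) else ((e, i), true)
  else x.

Definition dual_place_inv (x : arrow_end (edge G)) : arrow_end (edge G) :=
  let: ((e, i), b) := x in
  if e \in A then if b then ((e, i), false) else ((e, ~~ i), true)
  else x.

Lemma dual_placeK : cancel dual_place dual_place_inv.
Proof.
by case=> [[e i] b]; rewrite /dual_place; case: ifP => eA;
   [case: b | ]; rewrite /dual_place_inv eA ?negbK.
Qed.

Lemma dual_place_invK : cancel dual_place_inv dual_place.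
Proof.
by case=> [[e i] b]; rewrite /dual_place_inv; case: ifP => eA;
   [case: b | ]; rewrite /dual_place eA ?negbK.
Qed.

Definition dual_arc (x : arrow_end (edge G)) : arrow_end (edge G) :=
  dual_place_inv (arc (dual_place x)).

Lemma dual_arcK : involutive dual_arc.
Proof. by move=> x; rewrite /dual_arc dual_place_invK arcK dual_placeK. Qed.

Lemma dual_arc_neq x : dual_arc x != x.
Proof.
apply/eqP => /(congr1 dual_place); rewrite dual_place_invK.
by apply/eqP/arc_neq.
Qed.

Definition partial_dual : ribbon_graph :=
  {| edge := edge G; bare := bare G; arc := dual_arc;
     arcK := dual_arcK; arc_neq := dual_arc_neq |}.

End PartialDual.

(** ** Deletion of edges *)

Section Deletion.
Variables (G : ribbon_graph) (A : {set edge G}).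

Definition kept (x : arrow_end (edge G)) : bool := edge_of x \notin A.

(* [walk n x] is the arrow end reached from [x] along the circle by following
   an arc and then, [n] times, an arrow and an arc. *)
Definition walk (n : nat) (x : arrow_end (edge G)) : arrow_end (edge G) :=
  iter n (fun y => arc (across y)) (arc x).

Lemma walkS n x : walk n.+1 x = arc (across (walk n x)).
Proof. by []. Qed.

Lemma walkSr n x : walk n.+1 x = walk n (across (arc x)).
Proof. by rewrite /walk iterSr. Qed.

Lemma walkK n : involutive (walk n).
Proof.
elim: n => [|n IHn] x; first exact: arcK.
by rewrite walkSr walkS arcK acrossK IHn.
Qed.

Lemma walk_neq n x : walk n x != x.
Proof.
elim/ltn_ind: n x => -[|[|n]] IHn x; first exact: arc_neq.
  rewrite walkS; apply/eqP => /(congr1 (@arc G)); rewrite arcK.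
  by apply/eqP/across_neq.
rewrite walkS walkSr.
apply/eqP => /(congr1 (@arc G))/(congr1 (@across _)); rewrite arcK acrossK.
by apply/eqP/IHn.
Qed.

Lemma walk_sub m n x : m < n -> walk m (walk n x) = across (walk (n - m).-1 x).
Proof.
elim: m n x => [|m IHm] [|n] x lt_mn //.
  by rewrite subn0 walkS [walk 0 _]arcK.
rewrite walkSr walkS arcK acrossK subSS.
by rewrite IHm.
Qed.

Lemma kept_across x : kept (across x) = kept x.
Proof. by []. Qed.

Lemma walk_kept x : kept x -> exists n, kept (walk n x).
Proof.
move=> kx; pose f (y : arrow_end (edge G)) := arc (across y).
have injf : injective f.
  exact: inj_comp (can_inj (@arcK G)) (can_inj (@acrossK _)).
have cf : fconnect f (arc x) (across x).
  rewrite fconnect_sym //.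
  by have := fconnect1 f (across x); rewrite /f acrossK.
by exists (findex f (arc x) (across x)); rewrite /walk iter_findex.
Qed.

Definition kept_edge : finType := {e : edge G | e \notin A}.

Definition old_end (x : arrow_end kept_edge) : arrow_end (edge G) :=
  ((val x.1.1, x.1.2), x.2).

Lemma kept_old_end x : kept (old_end x).
Proof. exact: valP x.1.1. Qed.

Lemma old_end_inj : injective old_end.
Proof. by move=> [[e i] b] [[f j] c] [/val_inj -> -> ->]. Qed.

Definition skip (x : arrow_end kept_edge) : arrow_end (edge G) :=
  walk (ex_minn (walk_kept (kept_old_end x))) (old_end x).

Lemma kept_skip x : kept (skip x).
Proof. by rewrite /skip; case: ex_minnP. Qed.

Definition delete_arc (x : arrow_end kept_edge) : arrow_end kept_edge :=
  ((Sub (edge_of (skip x)) (kept_skip x), (skip x).1.2), (skip x).2).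

Lemma old_end_delete_arc x : old_end (delete_arc x) = skip x.
Proof. by rewrite /old_end /= /edge_of; case: (skip x) => [[]]. Qed.

Lemma delete_arcK : involutive delete_arc.
Proof.
move=> x; apply: old_end_inj; rewrite old_end_delete_arc /skip.
case: ex_minnP => m; rewrite old_end_delete_arc /skip.
case: ex_minnP => n kn min_n km min_m.
have le_mn : m <= n by apply: min_m; rewrite walkK kept_old_end.
case: (ltngtP m n) le_mn => // [lt_mn _|-> _]; last exact: walkK.
move: km; rewrite walk_sub // kept_across => /min_n.
by rewrite leqNgt prednK ?subn_gt0 // => /negP[]; rewrite leq_subr.
Qed.

Lemma delete_arc_neq x : delete_arc x != x.
Proof.
apply/eqP => /(congr1 old_end); rewrite old_end_delete_arc.
by apply/eqP/walk_neq.
Qed.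

(* The isolated vertices of [G - A] are the vertices of [G] all of whose
   incident edges, if any, lie in [A]. *)
Definition delete_edges : ribbon_graph :=
  {| edge := kept_edge;
     bare := {v : vertex G |
                [forall a, (vertex_of a == v) ==> (a.1 \in A)]};
     arc := delete_arc;
     arcK := delete_arcK;
     arc_neq := delete_arc_neq |}.

End Deletion.

Definition contract_edges (G : ribbon_graph) (A : {set edge G}) : ribbon_graph :=
  @delete_edges (partial_dual A) A.

(* Main.v *)
(** A checkerboard colouring is the same thing as a 2-colouring of the arrow
  ends that is constant along the arcs and along the edge line segments and
  changes across every arrow.  Contracting [A = E(F)] keeps the arcs, and
  exchanges the arrows of [A] with their edge line segments before suppressing
  them; hence colourings of [G] induce colourings of [G / A], and a colouring of
  [G / A] comes from a colouring [c] of the ends of [G] that is constant along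
  arcs and edge line segments and changes across the arrows not in [A].  On each
  vertex circle [c] changes across an even number of arrows, as it is constant
  along arcs.  As [G] is Eulerian, the number of arrows of the circle across
  which [c] does not change is even as well, in particular it is not 1.  The
  edges of these arrows thus form a subgraph of [F] without leaves, which is
  empty because [F] is a forest. *)

From mathcomp Require Import all_boot.
Require Import Defs.

Set Implicit Arguments.
Unset Strict Implicit.
Unset Printing Implicit Defensive.

(** * Components of a relation and fixed-point free involutions *)

Section ComponentTheory.
Variables (T : finType) (r : rel T).
Hypothesis sym_r : symmetric r.

Lemma eq_component_of x y :
  connect r x y -> component_of r x = component_of r y.
Proof.
move=> cxy; apply: val_inj; apply/setP => z /=; rewrite !inE.
exact: (same_connect (sym_connect_sym sym_r)).
Qed.

Lemma invariant_connect (rT : Type) (c : T -> rT) :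
  (forall x y, r x y -> c y = c x) -> forall x y, connect r x y -> c y = c x.
Proof.
move=> cr x y /connectP[p rp ->] {y}.
by elim: p x rp => //= z p IHp x /andP[/cr <- /IHp].
Qed.

End ComponentTheory.

Lemma symmetric_involutions (T : eqType) (f g : T -> T) :
  involutive f -> involutive g ->
  symmetric (fun x y => (y == f x) || (y == g x)).
Proof.
move=> fK gK x y; congr orb.
  by apply/eqP/eqP => ->; rewrite ?fK.
by apply/eqP/eqP => ->; rewrite ?gK.
Qed.

Lemma circle_rel_sym (G : ribbon_graph) : symmetric (@circle_rel G).
Proof. exact: symmetric_involutions (@acrossK _) (@arcK G). Qed.

Lemma boundary_rel_sym (G : ribbon_graph) : symmetric (@boundary_rel G).
Proof. exact: symmetric_involutions (@sideK _) (@arcK G). Qed.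

(** The orbits of [f] cut [A] into pairs; the induction removes one pair at a time. *)
Lemma even_invariant (T : finType) (f : T -> T) (A : {set T}) :
  involutive f -> (forall x, f x != x) -> (forall x, (f x \in A) = (x \in A)) ->
  ~~ odd #|A|.
Proof.
move=> fK f_neq fA; elim: {A}_.+1 {-2}A (ltnSn #|A|) fA => // n IHn A leAn fA.
have [->|[x xA]] := set_0Vmem A; first by rewrite cards0.
have fxA : f x \in A :\ x by rewrite !inE f_neq fA.
have cardA : #|A| = #|A :\ x :\ f x|.+2.
  by rewrite (cardsD1 x) xA (cardsD1 (f x) (A :\ x)) fxA.
rewrite cardA /= negbK; apply: IHn; first by rewrite cardA in leAn; apply: ltnW.
by move=> y; rewrite !inE fA (can_eq fK) (inv_eq fK) andbCA.
Qed.

(** * Checkerboard colourings as colourings of arrow ends *)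

Section Colourings.
Variable G : ribbon_graph.
Implicit Types (c : arrow_end (edge G) -> bool).

Definition end_colouring c : Prop :=
  [/\ forall x, c (arc x) = c x, forall x, c (side x) = c x
    & forall x, c (across x) = ~~ c x].

(** An edge line segment joins the head of one arrow of its edge to the tail of the other, so the
    two segments differ in colour exactly when the colour changes across both arrows. *)
Lemma checkerboard_colourableP :
  checkerboard_colourable G <-> exists c, end_colouring c.
Proof.
split=> [[c c_neq] | [c [c_arc c_side c_across]]].
  pose d x := c (inl (component_of (@boundary_rel G) x)).
  have dr x y : boundary_rel x y -> d y = d x.
    move=> rxy; rewrite /d; congr (c (inl _)); apply/esym.
    exact: eq_component_of (@boundary_rel_sym G) _ _ (connect1 rxy).
  have d_side x : d (side x) = d x by apply: dr; rewrite /boundary_rel eqxx.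
  exists d; split=> // [x|].
    by apply: dr; rewrite /boundary_rel eqxx orbT.
  have d_neq e : d ((e, false), true) = ~~ d ((e, true), true).
    have := c_neq e; rewrite /segment_boundary -/(d _) -/(d _).
    by do 2!case: (d _).
  have d_tail e i : d ((e, i), false) = d ((e, ~~ i), true) by rewrite -d_side.
  by move=> [[e []] []]; rewrite /across /= d_tail /= d_neq ?negbK.
(* A component takes the common colour of its ends. Isolated vertices meet no edge, so their colour
   is arbitrary. *)
exists (fun v : boundary_component G =>
  if v is inl C then [exists x in val C, c x] else false) => e.
have cE x : [exists y in component_set (@boundary_rel G) x, c y] = c x.
  have c_r y z : boundary_rel y z -> c z = c y by case/orP=> /eqP->.
  apply/existsP/idP => [[y]|cx].
    by rewrite inE => /andP[/(invariant_connect c_r) ->].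
  by exists x; rewrite inE connect0.
rewrite /= !cE -(c_side (e, true, true)) -[side _]/(across (e, false, true)).
by rewrite c_across; case: (c _).
Qed.

End Colourings.

(** * Cycles in reduced walks *)

Section Cycles.
Variables (G : ribbon_graph) (u : nat -> arrow (edge G)).
Hypothesis u_walk : forall n, vertex_of (u n.+1) = vertex_of (opposite (u n)).
Hypothesis u_reduced : forall n, u n.+1 != opposite (u n).

(** By the pigeonhole principle some vertex repeats. At the first repetition [v i = v j] the
    vertices before [j] are distinct, and reducedness makes the edges distinct as well. *)
Lemma reduced_walk_cycle : exists i m, graph_cycle [seq u k | k <- iota i m.+1].
Proof.
pose v n := vertex_of (u n).
have exP : exists j, [exists i : 'I_j, v i == v j].
  pose N := #|vertex G|.+1.
  have : ~~ injectiveb (fun i : 'I_N => v i).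
    by apply/injectiveP => /leq_card; rewrite card_ord ltnn.
  case/injectivePn=> i [j neq_ij eq_v].
  case: (ltngtP i j) neq_ij => [lt_ij|lt_ji|/val_inj ->]; last by rewrite eqxx.
    by exists j; apply/existsP; exists (Ordinal lt_ij); rewrite /= eq_v.
  by exists i; apply/existsP; exists (Ordinal lt_ji); rewrite /= eq_v.
case: (ex_minnP exP) => j /existsP[[i lt_ij] /eqP /= eq_v] min_j.
have neq_v k l : k < l -> l < j -> v k != v l.
  move=> lt_kl lt_lj; apply: contraTN lt_lj => eq_kl; rewrite -leqNgt.
  by apply/min_j/existsP; exists (Ordinal lt_kl).
have v_inj k l : k < j -> l < j -> v k = v l -> k = l.
  move=> ltk ltl; case: (ltngtP k l) => // lt_kl /eqP.
    by rewrite (negPf (neq_v _ _ lt_kl ltl)).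
  by rewrite eq_sym (negPf (neq_v _ _ lt_kl ltk)).
have e_lt k l : k < l -> l < j -> (u k).1 != (u l).1.
  move=> lt_kl lt_lj; apply/eqP => eq_e.
  have eq_u : (u l = u k) \/ (u l = opposite (u k)).
    by case: (u k) (u l) eq_e => [e []] [f []] /= ->; [left|right|right|left].
  (* The same arrow would repeat a vertex; the opposite one starts at [v k.+1], which forces
     [l = k.+1], an immediate backtracking. *)
  case: eq_u => eq_u.
    by have := neq_v _ _ lt_kl lt_lj; rewrite /v eq_u eqxx.
  have eq_l : k.+1 = l.
    by apply: v_inj; rewrite ?(leq_ltn_trans lt_kl) // /v eq_u u_walk.
  by have := u_reduced k; rewrite eq_l eq_u eqxx.
have e_inj k l : k < j -> l < j -> (u k).1 = (u l).1 -> k = l.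
  move=> ltk ltl; case: (ltngtP k l) => // lt_kl /eqP.
    by rewrite (negPf (e_lt _ _ lt_kl ltl)).
  by rewrite eq_sym (negPf (e_lt _ _ lt_kl ltk)).
exists i, (j - i).-1; have size_eq : (j - i).-1.+1 = j - i.
  by rewrite prednK // subn_gt0.
have iota_lt k : k \in iota i (j - i).-1.+1 -> k < j.
  by rewrite size_eq mem_iota subnKC ?(ltnW lt_ij) // => /andP[].
have uniq_u (T : eqType) (f : arrow (edge G) -> T) :
    (forall k l, k < j -> l < j -> f (u k) = f (u l) -> k = l) ->
    uniq [seq f a | a <- [seq u k | k <- iota i (j - i).-1.+1]].
  move=> f_inj; rewrite -map_comp map_inj_in_uniq ?iota_uniq //.
  by move=> k l /iota_lt ltk /iota_lt; apply: f_inj.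
apply/and4P; split=> //.
- set m := (j - i).-1; rewrite /= rcons_path.
  have -> : last (u i) [seq u k | k <- iota i.+1 m] = u (i + m).
    rewrite last_map; congr u; elim: (m) (i) => [|k IHk] l.
      by rewrite addn0.
    by rewrite /= IHk addSnnS.
  rewrite -u_walk -addnS size_eq subnKC ?(ltnW lt_ij) //
    -/(v i) -/(v j) eq_v eqxx.
  by rewrite andbT; elim: m (i) => //= k IHk l; rewrite u_walk eqxx IHk.
- exact: (uniq_u _ (fun a => a.1)).
exact: (uniq_u _ (fun a => vertex_of a)).
Qed.

End Cycles.

(** * Leafless subgraphs of forests and parity of colour changes *)

Section Forests.
Variable G : ribbon_graph.

(** In a nonempty [S] one can walk forever without backtracking, as each vertex reached carries a
    second arrow of [S]; such a walk contains a cycle of [F]. *)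
Lemma forest_leaf (F : ribbon_subgraph G) (S : {set arrow (edge G)}) :
  forest F ->
  (forall a, a \in S -> a.1 \in sub_edges F) ->
  (forall a, a \in S -> opposite a \in S) ->
  (forall v, #|[set a in S | vertex_of a == v]| != 1) ->
  S = set0.
Proof.
move=> forestF SF S_opp S_leafless; have [//|[a0 a0S]] := set_0Vmem S.
have next_ex a : a \in S -> exists b,
    [&& b \in S, vertex_of b == vertex_of (opposite a) & b != opposite a].
  move=> aS; apply/existsP.
  apply: contraR (S_leafless (vertex_of (opposite a))).
  rewrite negb_exists => /forallP none; apply/cards1P.
  exists (opposite a); apply/setP => b; rewrite !inE.
  apply/andP/eqP => [[bS bv]|->]; last by rewrite S_opp.
  by have := none b; rewrite bS bv /= negbK => /eqP.
(* By [next_ex], the default is never reached for [a] in [S]. *)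
pose next a := odflt a [pick b | [&& b \in S,
  vertex_of b == vertex_of (opposite a) & b != opposite a]].
have nextP a : a \in S -> [&& next a \in S,
    vertex_of (next a) == vertex_of (opposite a) & next a != opposite a].
  move=> /next_ex[b Pb]; rewrite /next.
  by case: pickP => [//|/(_ b)]; rewrite Pb.
pose u n := iter n next a0.
have uS n : u n \in S by elim: n => //= n /nextP /and3P[].
have [n|n|i [m cyc]] := @reduced_walk_cycle G u.
- by have /and3P[_ /eqP] := nextP _ (uS n).
- by have /and3P[] := nextP _ (uS n).
apply: contraTeq cyc => _; apply: forestF.
move=> _ /mapP[_ /mapP[k _ ->] ->].
exact: SF.
Qed.

Variable c : arrow_end (edge G) -> bool.
Hypothesis c_arc : forall x, c (arc x) = c x.

(** The ends at [v] coloured [true] are paired by [arc], and an arrow contributes an odd number of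
    them exactly when its two ends differ in colour. *)
Lemma even_changes (v : vertex G) :
  ~~ odd #|[set a | (vertex_of a == v) && (c (a, true) != c (a, false))]|.
Proof.
pose w (x : arrow_end (edge G)) : vertex G :=
  inl (component_of (@circle_rel G) x).
have w_r x y : circle_rel x y -> w y = w x.
  move=> rxy; congr inl; apply/esym.
  exact: eq_component_of (@circle_rel_sym G) _ _ (connect1 rxy).
have w_arc x : w (arc x) = w x by apply: w_r; rewrite /circle_rel eqxx orbT.
have w_across x : w (across x) = w x by apply: w_r; rewrite /circle_rel eqxx.
have evenX : ~~ odd #|[set x | (w x == v) && c x]|.
  apply: (even_invariant (@arcK G) (@arc_neq G)) => x.
  by rewrite !inE w_arc c_arc.
have card_sum (T : finType) (P : pred T) : #|[set x | P x]| = \sum_x P x.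
  rewrite cardsE -sum1_card big_mkcond; apply: eq_bigr => x _.
  by rewrite unfold_in; case: (P x).
apply: contraNN evenX; rewrite !card_sum.
rewrite [X in _ -> odd X](_ : _ =
  \sum_a \sum_b ((w (a, b) == v) && c (a, b))); last first.
  by rewrite pair_bigA; apply: eq_bigr => -[a b].
(* Both parities become exclusive-or sums over arrows, compared term by term. *)
rewrite !(big_morph odd oddD (erefl : odd 0 = false)).
congr is_true; apply: eq_bigr => a _; rewrite /= big_bool /=.
have w_false : w (a, false) = w (a, true) by rewrite -w_across.
rewrite -[vertex_of a]/(w (a, true)) w_false.
by case: eqP => //= _; case: (c _); case: (c _).
Qed.

Lemma forest_across (F : ribbon_subgraph G) :
  Eulerian G -> forest F ->
  (forall x, c (side x) = c x) ->
  (forall x, edge_of x \notin sub_edges F -> c (across x) = ~~ c x) ->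
  forall x, c (across x) = ~~ c x.
Proof.
move=> eulerG forestF c_side c_across.
pose S := [set a | c (a, true) == c (a, false)].
have S0 : S = set0.
  apply: (forest_leaf forestF) => [a|[e i]|v]; rewrite ?inE.
  - apply: contraTT => /(c_across (a, false)) /= ->.
    by case: c.
  (* The edge line segments transport a change across one arrow of an edge to
     its other arrow. *)
  - have c_opp b : c ((e, ~~ i), b) = c ((e, i), ~~ b).
      by rewrite -c_side /side /= negbK.
    by rewrite /opposite !c_opp eq_sym.
  (* Outside [S] the arrows at [v] are those where [c] changes, so this count is an even degree
     minus an even number. *)
  suff : ~~ odd #|[set a in S | vertex_of a == v]| by case: #|_| => [|[]].
  have := eulerG v; rewrite /degree.
  rewrite -(cardsID S) oddD (_ : _ :\: S =
    [set a | (vertex_of a == v) && (c (a, true) != c (a, false))]).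
    rewrite (negPf (even_changes v)) addbF; congr (~~ odd #|pred_of_set _|).
    by apply/setP => a; rewrite !inE andbC.
  by apply/setP => a; rewrite !inE andbC.
move=> [a b]; have := in_set0 a; rewrite -S0 inE /across /=.
by case: b => /=; do 2!case: (c _).
Qed.

End Forests.

(** * Colourings constant along arcs, before and after deletion *)

Section DeletionExtension.
Variables (H : ribbon_graph) (A : {set edge H}).

(** A new arc is a walk through old arcs and deleted arrows only, by minimality of its length, and
    [c] is constant along both. *)
Lemma delete_arc_invariant (c : arrow_end (edge H) -> bool) :
  (forall x, c (arc x) = c x) ->
  (forall x, ~~ kept A x -> c (across x) = c x) ->
  forall x : arrow_end (kept_edge A),
    c (old_end (delete_arc x)) = c (old_end x).
Proof.
move=> c_arc c_across x; rewrite old_end_delete_arc /skip.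
case: ex_minnP => n _ min_n.
have unkept k : k < n -> ~~ kept A (walk k (old_end x)).
  by rewrite ltnNge; apply: contra => /min_n.
elim: n unkept {min_n} => [|n IHn] unkept; first exact: c_arc.
rewrite walkS c_arc c_across ?unkept // IHn // => k lt_kn.
by rewrite unkept // ltnW.
Qed.

(** Its classes are the strands left when kept arrows are cut out: the new arcs, and closed curves
    without kept ends. *)
Definition suppressed_rel : rel (arrow_end (edge H)) :=
  fun x y => (y == arc x) || (~~ kept A x && (y == across x)).

Lemma suppressed_connect (x y : arrow_end (kept_edge A)) :
  connect suppressed_rel (old_end x) (old_end y) ->
  y = x \/ y = delete_arc x.
Proof.
pose ox := old_end x; pose unkept k := forall i, i < k -> ~~ kept A (walk i ox).
(* The ends met from [ox] up to the first kept one: either end of a deleted arrow on the walk, or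
   the kept end that stops it. *)
pose P z := z = ox \/ exists2 k, unkept k &
  z = walk k ox \/ ~~ kept A (walk k ox) /\ z = across (walk k ox).
have Pr z t : suppressed_rel z t -> P z -> P t.
  case/orP=> [/eqP->|/andP[Uz /eqP->]] [z_ox|[k Uk [z_k|[Ukk z_k]]]].
  - by right; exists 0 => //; left; rewrite z_ox.
  - case: k z_k Uk => [|k] -> Uk.
      by left; rewrite [walk 0 _]/(arc _) arcK.
    right; exists k => [i lt_ik|]; first by rewrite Uk // ltnW.
    by right; rewrite Uk // walkS arcK.
  - right; exists k.+1 => [i|]; last by left; rewrite z_k.
    by rewrite ltnS leq_eqVlt => /orP[/eqP->|/Uk].
  - by rewrite z_ox kept_old_end in Uz.
  - by right; exists k => //; right; rewrite -z_k.
  by right; exists k => //; left; rewrite z_k acrossK.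
have Pc z t : connect suppressed_rel z t -> P z -> P t.
  case/connectP=> p rp -> {t}; elim: p z rp => //= t p IHp z /andP[/Pr zt /IHp].
  by auto.
move=> /Pc[|/old_end_inj|[k Uk y_k]]; [by left | by left | right].
have ky := kept_old_end y; case: y_k => [y_k|[Ukk y_k]]; last first.
  by rewrite y_k kept_across (negPf Ukk) in ky.
apply: old_end_inj; rewrite old_end_delete_arc /skip y_k -/ox; congr (walk _ _).
case: ex_minnP => n kn /(_ k); rewrite -y_k ky => /(_ isT) le_nk.
by case: (ltngtP n k) le_nk => // /Uk; rewrite kn.
Qed.

(** Each strand inherits the colour shared by its kept ends; a strand without kept ends gets
    [false]. *)
Lemma delete_arc_extension (c : arrow_end (kept_edge A) -> bool) :
  (forall x, c (delete_arc x) = c x) ->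
  exists d : arrow_end (edge H) -> bool,
    [/\ forall x, d (arc x) = d x,
        forall x, ~~ kept A x -> d (across x) = d x
      & forall x, d (old_end x) = c x].
Proof.
move=> c_arc; exists (fun x =>
  [exists y, connect suppressed_rel (old_end y) x && c y]).
have d_le x y : suppressed_rel x y ->
    [exists z, connect suppressed_rel (old_end z) x && c z] ->
    [exists z, connect suppressed_rel (old_end z) y && c z].
  move=> rxy /existsP[z /andP[czx cz]]; apply/existsP; exists z.
  by rewrite cz (connect_trans czx (connect1 rxy)).
split=> [x|x Ux|x]; apply/idP/idP.
- by apply: d_le; rewrite /suppressed_rel arcK eqxx.
- by apply: d_le; rewrite /suppressed_rel eqxx.
- by apply: d_le; rewrite /suppressed_rel kept_across acrossK eqxx Ux orbT.
- by apply: d_le; rewrite /suppressed_rel eqxx Ux orbT.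
- by case/existsP=> y /andP[/suppressed_connect[]-> //]; rewrite c_arc.
by move=> cx; apply/existsP; exists x; rewrite connect0.
Qed.

End DeletionExtension.

Theorem theorem4p3 (G : ribbon_graph) (F : ribbon_subgraph G) :
  Eulerian G -> forest F ->
  (checkerboard_colourable G <->
   checkerboard_colourable (contract_edges (sub_edges F))).
Proof.
move=> eulerG forestF.
set A := sub_edges F; pose H := partial_dual A.
have place_old (x : arrow_end (@kept_edge H A)) :
    dual_place A (old_end x) = old_end x.
  by have := kept_old_end x; case: x => [[e i] b]; rewrite /kept /= => /negPf->.
split=> /checkerboard_colourableP[c [c_arc c_side c_across]];
  apply/checkerboard_colourableP.
  exists (fun x : arrow_end (@kept_edge H A) => c (old_end x)); split=> x.
  - pose d (y : arrow_end (edge H)) := c (dual_place A y).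
    have d_arc y : d (arc y) = d y.
      by rewrite /d [arc y]/(dual_arc A y) dual_place_invK.
    (* For edges in [A], [dual_place] turns [across] in the dual into [side] in [G]. *)
    have d_across y : ~~ kept A y -> d (across y) = d y.
      case: y => [[e i] b]; rewrite negbK /d /across /= /edge_of /= => ->.
      have side_across j : c (e, ~~ j, false) = c (e, j, true).
        by rewrite -[in RHS]c_side.
      by case: b; rewrite /= side_across.
    by have := delete_arc_invariant d_arc d_across x; rewrite /d !place_old.
  - exact: (c_side (old_end x)).
  exact: (c_across (old_end x)).
(* Conversely, the colouring is extended to the partial dual and carried back to the ends of [G]. *)
have [d [d_arc d_across d_old]] := delete_arc_extension c_arc.
pose c0 (x : arrow_end (edge G)) := d (dual_place_inv A x).
have c0_old x : c0 (old_end x) = c x.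
  have := dual_placeK A (old_end x); rewrite place_old /c0 => ->.
  exact: d_old.
have oldP (x : arrow_end (edge G)) : edge_of x \notin A ->
    exists y : arrow_end (@kept_edge H A), x = old_end y.
  by case: x => [[e i] b] eA; exists ((exist _ e eA, i), b).
have c0_arc x : c0 (arc x) = c0 x.
  rewrite /c0 -[in LHS](dual_place_invK A x).
  exact: (d_arc (dual_place_inv A x)).
(* For an edge in [A] this is constancy across a deleted arrow of the dual; for a kept edge it is
   [c_side]. *)
have c0_side x : c0 (side x) = c0 x.
  have [xA|/oldP[y ->]] := boolP (edge_of x \in A); last first.
    by rewrite -[side _]/(old_end (side y)) !c0_old c_side.
  rewrite /c0 -[RHS]d_across.
    by case: x xA => [[e i] []]; rewrite /edge_of /side /= => ->; rewrite ?negbK.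
  by case: x xA => [[e i] []]; rewrite /edge_of /kept /= => eA; rewrite eA negbK.
exists c0; split=> //; apply: (forest_across c0_arc eulerG forestF c0_side).
move=> _ /oldP[y ->].
by rewrite -[across _]/(old_end (across y)) !c0_old c_across.
Qed.
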